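(* Let $N,K,L\in\mathbb{N}=\{1,2,\dots\}$, and let $M,M'\in\mathbb{N}\setminus\{1\}$ with $M'\neq M$. Let $C=\left(1+\frac1N+\frac1{N^2}+\cdots+\frac1{N^{K-1}}\right)^{-1}$ and $L'=\lceil L\log_{M'}M\rceil$. Consider private information retrieval (PIR) with $N$ databases, each storing all $K$ messages, each message comprised of $L$ symbols from an $M$-ary alphabet, where the downloads are comprised of symbols from an $M'$-ary alphabet. Then the optimal download cost $D_L$ (the minimum, over all PIR schemes, of the download cost in $M'$-ary symbols) satisfies $$D_L\in\left\{\left\lceil\frac{L'}{C}\right\rceil,\ \left\lceil\frac{L'}{C}\right\rceil-1,\ \left\lceil\frac{L'}{C}\right\rceil-2\right\}.$$
   Context: Notation: $[a:b]=\{a,a+1,\dots,b\}$; $X\sim Y$ means that $X$ and $Y$ are identically distributed; $|A|$ is the length of a tuple $A$. PIR problem. There are $K$ messages $W_1,\dots,W_K$, each an arbitrary string $W_k=(W_k(1),\dots,W_k(L))\in[0:M-1]^L$ (every realization is possible). There are $N$ databases, each storing all the messages. A PIR scheme consists of the following. For each desired message index $\theta\in[1:K]$ the user privately generates random queries $Q_1^{[\theta]},\dots,Q_N^{[\theta]}$, without any knowledge of the message realizations, and sends $Q_n^{[\theta]}$ to database $n$ for each $n\in[1:N]$. Database $n$ returns an answering string $A_n^{[\theta]}$, which is a function of $Q_n^{[\theta]}$ and $W_1,\dots,W_K$ and is comprised of $M'$-ary symbols, $A_n^{[\theta]}\in[0:M'-1]^{|A_n^{[\theta]}|}$. The scheme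 must satisfy: [Correctness] for each $\theta\in[1:K]$, $W_\theta$ is a function of $A_1^{[\theta]},\dots,A_N^{[\theta]},Q_1^{[\theta]},\dots,Q_N^{[\theta]}$; [Privacy] $Q_n^{[\theta]}\sim Q_n^{[\theta']}$ for all $\theta,\theta'\in[1:K]$ and $n\in[1:N]$. The download cost of a PIR scheme is $D=\max\sum_{n=1}^N|A_n^{[\theta]}|$, the maximum value (across all random realizations of the queries) of the total number of $M'$-ary symbols downloaded by the user from all the databases. The optimal download cost $D_L$ is the minimum of $D$ over all PIR schemes (including non-linear ones) with message length $L$, for the given $N,K,M,M'$.
   Formalization: The formal theorem additionally assumes N ≥ 2 or K ≤ 3; with N = 1 and any K ≥ 4 the claim fails, e.g. N=1, K=4, L=1, M=5, M'=4 gives D_L ≤ 5 while the claimed set is {8,7,6}. *)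

(* Defs.v *)
From HB Require Import structures.
From mathcomp Require Import all_boot all_order all_algebra.
From mathcomp Require Import all_classical all_reals all_analysis.

Set Implicit Arguments.
Unset Strict Implicit.
Unset Printing Implicit Defensive.

Import Order.TTheory GRing.Theory Num.Theory.
Local Open Scope classical_set_scope.
Local Open Scope ring_scope.

Definition messages (K L M : nat) := 'I_K -> L.-tuple 'I_M.

Definition identically_distributed (R : realType)
    (d d' : measure_display) (T : measurableType d) (T' : measurableType d')
    (P : probability T R) (X Y : {RV P >-> T'}) : Prop :=
  forall A : set T', measurable A -> distribution P X A = distribution P Y A.

(* A PIR scheme with N databases, K messages in [0 : M-1]^L and M'-ary
   downloads.
   - All the randomness is the user's and lives in a single probability space,
     so the queries do not depend on the messages. Using the same space for
     every desired index theta is no restriction: neither the axioms nor the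
     cost relate the queries of two different theta beyond their laws.
   - A database only sees its query, so pir_len and pir_answer depend neither
     on theta nor on the queries sent to the other databases. The length of an
     answer depends on the query alone, not on the messages.
   - pir_answer_measurable makes the answers random variables. It also
     prevents a too coarse sigma-algebra on the queries from voiding privacy. *)
Record pir_scheme (R : realType) (N K L M M' : nat) := PIRScheme {
  pir_disp : measure_display;
  pir_space : measurableType pir_disp;
  pir_prob : probability pir_space R;
  pir_query_disp : 'I_N -> measure_display;
  pir_query_type : forall n : 'I_N, measurableType (pir_query_disp n);
  pir_query : 'I_K -> forall n : 'I_N, {RV pir_prob >-> pir_query_type n};
  pir_len : forall n : 'I_N, pir_query_type n -> nat;
  pir_answer : forall (n : 'I_N) (q : pir_query_type n),
    messages K L M -> (pir_len q).-tuple 'I_M';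
  pir_answer_measurable : forall (n : 'I_N) (W : messages K L M) (s : seq 'I_M'),
    measurable [set q : pir_query_type n | tval (pir_answer q W) = s];
  pir_correct : forall theta : 'I_K,
    exists decode : (forall n : 'I_N, pir_query_type n) ->
                    ('I_N -> seq 'I_M') -> L.-tuple 'I_M,
      forall (w : pir_space) (W : messages K L M),
        decode (fun n => pir_query theta n w)
               (fun n => tval (pir_answer (pir_query theta n w) W)) = W theta;
  pir_private : forall (theta theta' : 'I_K) (n : 'I_N),
    identically_distributed (pir_query theta n) (pir_query theta' n)
}.

Definition pir_download (R : realType) (N K L M M' : nat)
    (S : pir_scheme R N K L M M') (theta : 'I_K) (w : pir_space S) : nat :=
  (\sum_(n < N) pir_len (pir_query S theta n w))%N.

(* Relational, because the maximum need not exist when the query alphabets are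
   infinite. *)
Definition is_download_cost (R : realType) (N K L M M' : nat)
    (S : pir_scheme R N K L M M') (D : nat) : Prop :=
  (exists (theta : 'I_K) (w : pir_space S), pir_download theta w = D) /\
  (forall (theta : 'I_K) (w : pir_space S), (pir_download theta w <= D)%N).

Definition is_optimal_download_cost (R : realType) (N K L M M' D : nat) : Prop :=
  (exists S : pir_scheme R N K L M M', is_download_cost S D) /\
  (forall (S : pir_scheme R N K L M M') (D' : nat),
     is_download_cost S D' -> (D <= D')%N).

Definition pir_capacity (R : realType) (N K : nat) : R :=
  (\sum_(k < K) (N%:R ^+ k)^-1)^-1.

Definition log_base (R : realType) (b x : R) : R := ln x / ln b.

(* Main.v *)
Require Import Defs.
From HB Require Import structures.
From mathcomp Require Import all_boot all_order all_algebra perm.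
From mathcomp Require Import zify ring lra.
From mathcomp Require Import all_classical all_reals all_analysis.
From mathcomp Require Import measurable_realfun.

Set Implicit Arguments.
Unset Strict Implicit.
Unset Printing Implicit Defensive.

Import Order.TTheory GRing.Theory Num.Theory.
Local Open Scope ring_scope.

(* Lower bound: fix a scheme and let the messages be uniform.  Let E_k be the
   expectation of the sum over the databases of the entropy of the answer given
   the query and the first k messages.  By privacy E_k does not depend on the
   desired index.  When message k is desired, the joint answers determine it,
   and their entropy given the first k messages lies between the average and the
   sum over the databases; so E_k >= L ln M + E_(k+1) / N.  Since
   E_0 <= D ln M', this gives D >= x / C with x = L log_M' M, and
   L' / C < x / C + 1 / C costs at most two more symbols after rounding.

   Upper bound: embed the messages into L' symbols over M' letters and cut these
   into blocks.  A block of N^(K-1) symbols is retrieved with the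
   1 + N + ... + N^(K-1) downloads of a capacity achieving scheme; a block of
   t < N symbols is retrieved with t + 1 downloads by hiding one zero among the
   symbols.  Writing L' = a N^(K-1) + m (N-1) + t, the rounding losses of the
   m + 1 short blocks add up to less than one symbol. *)

(** * Combinatorial schemes *)

(* Each [x : X] is one downloaded symbol, asked from database [db x]; [Om] is the
   user's uniform randomness.  Privacy is witnessed by relabelling [Om]. *)
Definition symbol_scheme (N K : nat) (A B : Type) (D : nat) : Prop :=
  exists (Om X : finType) (db : X -> 'I_N)
         (val : 'I_K -> Om -> X -> ('I_K -> A) -> B),
  [/\ inhabited Om, #|X| = D,
      forall (th th' : 'I_K) (n : 'I_N), exists2 s : Om -> Om,
        injective s & forall w x, db x = n -> val th' (s w) x =1 val th w x
    & forall th w W W',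
        (forall x, val th w x W = val th w x W') -> W th = W' th].

Lemma symbol_scheme_inj (N K : nat) (A A' B : Type) (D : nat) (e : A -> A') :
  injective e -> symbol_scheme N K A' B D -> symbol_scheme N K A B D.
Proof.
move=> e_inj [Om [X [db [val [w0 cX priv corr]]]]].
exists Om, X, db, (fun th w x W => val th w x (e \o W)); split=> //.
  move=> th th' n; have [s s_inj sP] := priv th th' n.
  by exists s => // w x dbx W; apply: sP.
by move=> th w W W' eqv; apply: e_inj; exact: (corr th w (e \o W) (e \o W') eqv).
Qed.

Lemma symbol_scheme_unit (N K : nat) (B : Type) : symbol_scheme N K unit B 0.
Proof.
exists unit, void, (@of_void _), (fun _ _ x _ => of_void _ x).
split; [by split | by rewrite card_void | | ].
- by move=> th th' n; exists id => // w [].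
- by move=> th w W W' _; case: (W th) (W' th) => [] [].
Qed.

Lemma symbol_scheme_prod (N K : nat) (A1 A2 B : Type) (D1 D2 : nat) :
  symbol_scheme N K A1 B D1 -> symbol_scheme N K A2 B D2 ->
  symbol_scheme N K (A1 * A2) B (D1 + D2)%N.
Proof.
move=> [U1 [X1 [db1 [val1 [[w1] c1 p1 r1]]]]] [U2 [X2 [db2 [val2 [[w2] c2 p2 r2]]]]].
exists (U1 * U2)%type, (X1 + X2)%type,
  (fun x => match x with inl y => db1 y | inr y => db2 y end),
  (fun th w x W => match x with
     | inl y => val1 th w.1 y (fst \o W) | inr y => val2 th w.2 y (snd \o W) end).
split; [by split | by rewrite card_sum c1 c2 | | ].
  move=> th th' n; have [s1 i1 e1] := p1 th th' n; have [s2 i2 e2] := p2 th th' n.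
  exists (fun w => (s1 w.1, s2 w.2)).
    by move=> [a b] [a' b'] /= [/i1 -> /i2 ->].
  by move=> [a b] [y|y] /= ? W; [apply: e1|apply: e2].
move=> th [a b] W W' eqv.
have h1 := r1 th a (fst \o W) (fst \o W') (fun y => eqv (inl y)).
have h2 := r2 th b (snd \o W) (snd \o W') (fun y => eqv (inr y)).
by move: h1 h2 => /=; case: (W th) (W' th) => [? ?] [? ?] /= -> ->.
Qed.

(* Padding a message of [t] symbols with one zero makes the [t + 1] downloads of
   a round share the interference of a single download: the round in which the
   zero is retrieved reveals it. *)
Definition pad0 (t : nat) (G : zmodType) (w : {ffun 'I_t -> G}) (i : 'I_t.+1) : G :=
  if unlift ord0 i is Some j then w j else 0.

Lemma symbol_scheme_padded (N K t : nat) (G : zmodType) :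
  (t < N)%N -> symbol_scheme N K {ffun 'I_t -> G} G t.+1.
Proof.
move=> ltN.
pose val (th : 'I_K) (w : {ffun 'I_K -> 'I_t.+1}) (x : 'I_t.+1)
    (W : 'I_K -> {ffun 'I_t -> G}) :=
  \sum_k pad0 (W k) (w k + (if k == th then x else 0)).
exists {ffun 'I_K -> 'I_t.+1}, 'I_t.+1, (widen_ord ltN), val; split.
- by split; exact: [ffun=> ord0].
- by rewrite card_ord.
- move=> th th' n.
  (* Database [n] receives only round [n], so inside it a shift by [c] can be moved from message
     [th] to message [th']. For [n > t] the default of [inord] is harmless: no round is asked
     there. *)
  pose c : 'I_t.+1 := inord n.
  exists (fun w : {ffun 'I_K -> 'I_t.+1} => [ffun k => w k + (if k == th then c else 0)
                              - (if k == th' then c else 0)]).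
    move=> w w' /ffunP eqw; apply/ffunP => k; move: (eqw k); rewrite !ffunE.
    by move=> /addIr /addIr.
  move=> w x dbx W; have -> : x = c by rewrite /c -dbx inord_val.
  by apply: eq_bigr => k _; rewrite ffunE subrK.
move=> th w W W' eqv.
have valE x V : val th w x V = pad0 (V th) (w th + x) +
    \sum_(k | k != th) pad0 (V k) (w k).
  rewrite /val (bigD1 th) //= eqxx; congr (_ + _).
  by apply: eq_bigr => k /negPf ->; rewrite addr0.
(* Indices add modulo [t.+1], so round [- w th] reads the padding zero of message [th] and returns
   the bare interference. It is then cancelled from the round reading entry [lift ord0 j]. *)
have := eqv (- w th); rewrite !valE subrr /pad0 unlift_none !add0r -/pad0 => eqI.
apply/ffunP => j; have := eqv (lift ord0 j - w th).
by rewrite !valE eqI [w th + _]addrC subrK => /addIr; rewrite /pad0 liftK.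
Qed.

(** Built point by point: composing with the transposition of [tau (f x)] and [g x] corrects the new
    point and fixes the earlier images, which differ from both. It supplies the relabelling for
    privacy, with [f] and [g] the symbol positions that one database sees under two desired
    indices. *)
Lemma perm_transport (T I : finType) (f g : T -> I) (s : seq T) :
  {in s &, injective f} -> {in s &, injective g} ->
  exists tau : {perm I}, {in s, forall x, tau (f x) = g x}.
Proof.
elim: s => [|x s IHs] fI gI; first by exists 1%g.
have sub : {subset s <= x :: s} by move=> y ys; rewrite inE ys orbT.
have [tau tauE] := IHs (sub_in2 sub fI) (sub_in2 sub gI).
exists (tau * tperm (tau (f x)) (g x))%g => y; rewrite inE permM.
case: (eqVneq y x) => [->|yx] /=; first by rewrite tpermL.
move=> ys; have xs : x \in x :: s by exact: mem_head.
have gy : g x != g y by apply: contra_neq yx => /gI-> //; exact: sub.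
have fy : tau (f x) != g y.
  by rewrite -(tauE y ys); apply: contra_neq yx => /perm_inj/fI-> //; exact: sub.
by rewrite (tauE y ys) tpermD.
Qed.

(** * Blocks of N^(K-1) symbols *)

(* A pair [(i, u)] with [u] zero up to [i] stands for the vector over Z_N with
   first nonzero entry 1, at [i], and entries [u] after it.  It encodes one
   download, from the database indexed by the sum of [u]: the sum of one symbol
   of each message in the support of the vector.  When message [th] is desired,
   [side_info th] is the download with support [th] removed that supplies the
   interference; it comes from another database because the erased entry is
   nonzero. *)
Section LeadingVectors.
Variables (K n : nat).
Implicit Types (x : 'I_K * {ffun 'I_K -> 'I_n.+1}) (u : {ffun 'I_K -> 'I_n.+1}).
Implicit Types (i j k th : 'I_K).

Definition leading x : bool := [forall j : 'I_K, (j <= x.1)%N ==> (x.2 j == 0)].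

Definition involves x k : bool := (k == x.1) || (x.2 k != 0).

Definition database x : 'I_n.+1 := \sum_j x.2 j.

Definition erase j u : {ffun 'I_K -> 'I_n.+1} :=
  [ffun k => if k == j then 0 else u k].

Definition first_nonzero u : option 'I_K :=
  [pick j | (u j != 0) && [forall i : 'I_K, (i < j)%N ==> (u i == 0)]].

Definition side_info th x : 'I_K * {ffun 'I_K -> 'I_n.+1} :=
  if th == x.1 then
    if first_nonzero x.2 is Some j then (j, erase j x.2) else x
  else (x.1, erase th x.2).

Lemma leadingP x : reflect (forall j, (j <= x.1)%N -> x.2 j = 0) (leading x).
Proof.
apply: (iffP forallP) => h j; first by move=> hj; move: (h j); rewrite hj => /eqP.
by apply/implyP => /h /eqP.
Qed.

Lemma first_nonzeroP u k : u k != 0 ->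
  exists j, [/\ first_nonzero u = Some j, u j != 0 &
                forall i, (i < j)%N -> u i = 0].
Proof.
move=> uk; rewrite /first_nonzero; case: pickP => [j /andP[uj /forallP minj]|none].
  by exists j; split=> // i ij; move: (minj i); rewrite ij => /eqP.
case: (@arg_minnP _ k (fun j => u j != 0) (@nat_of_ord K) uk) => j uj jmin.
have := none j; rewrite uj /= => /negP[]; apply/forallP => i; apply/implyP => ij.
by apply: contraLR ij => /jmin; rewrite -leqNgt.
Qed.

Lemma sum_erase j u : \sum_k erase j u k = \sum_k u k - u j.
Proof.
rewrite (bigD1 j) //= [in RHS](bigD1 j) //= ffunE eqxx add0r addrAC subrr add0r.
by apply: eq_bigr => k /negPf kj; rewrite ffunE kj.
Qed.

Lemma erase_inj j u u' :
  erase j u = erase j u' -> \sum_k u k = \sum_k u' k -> u = u'.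
Proof.
move=> eqe; have := congr1 (fun v : {ffun _ -> _} => \sum_k v k) eqe.
rewrite /= !sum_erase => + eqs; rewrite eqs => /addrI/oppr_inj equ.
apply/ffunP => k; have [->//|kj] := eqVneq k j.
by move/ffunP: eqe => /(_ k); rewrite !ffunE (negPf kj).
Qed.

Lemma side_info_id th x : ~~ involves x th -> side_info th x = x.
Proof.
case: x => i u; rewrite /involves /side_info /= negb_or negbK.
case/andP=> /negPf -> /eqP uth; congr pair; apply/ffunP => k; rewrite ffunE.
by case: eqVneq => [->|].
Qed.

Lemma side_info_leading th k x :
  leading x -> involves x k -> k != th -> leading (side_info th x).
Proof.
case: x => i u /leadingP /= lead; rewrite /involves /side_info /= => ik kth.
have [thi|thi] := eqVneq th i; last first.
  by apply/leadingP => j /= ji; rewrite ffunE lead // if_same.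
have uk : u k != 0 by move: ik; rewrite -thi (negPf kth).
have [j [-> uj minj]] := first_nonzeroP uk.
apply/leadingP => l /=; rewrite ffunE; case: eqVneq => // lj jl.
by apply: minj; rewrite ltn_neqAle jl andbT.
Qed.

(** The second message [l] keeps the support nonempty once [th] is removed; a download of [th] alone
    is its own [side_info] and still involves [th]. *)
Lemma side_info_involves th k l x :
  leading x -> involves x l -> l != th ->
  involves (side_info th x) k = (k != th) && involves x k.
Proof.
case: x => i u /leadingP /= lead; rewrite /involves /side_info /= => il lth.
have [thi|thi] := eqVneq th i; last first.
  rewrite /= ffunE; case: (eqVneq k th) => [->|] //=.
  by rewrite (negPf thi).
have ul : u l != 0 by move: il; rewrite -thi (negPf lth).
have [j [-> uj minj]] := first_nonzeroP ul.
have ui0 : u i = 0 by exact: lead.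
rewrite /= ffunE thi; case: (eqVneq k j) => [->|kj] /=.
  by rewrite uj orbT andbT; symmetry; apply: contraNneq uj => ->; rewrite ui0.
by case: (eqVneq k i) => [->|]; rewrite ?ui0 ?eqxx.
Qed.

(** Knowing the database, that is the sum of the entries, recovers the erased entry from the others.
    If only [x] leads at [th], then [x'] leads later and has entry 0 at [th]; erasing there changes
    nothing, and comparing sums makes the entry erased from [x] zero, a contradiction. *)
Lemma side_info_inj th k x x' :
  leading x -> leading x' -> involves x k -> involves x' k -> k != th ->
  database x = database x' -> side_info th x = side_info th x' -> x = x'.
Proof.
wlog : x x' / (x'.1 == th) ==> (x.1 == th).
  move=> wl lx lx' ik ik' kth eqd eqs.
  case: (eqVneq x.1 th) => [e|ne]; first by apply: wl => //; rewrite e eqxx implybT.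
  by symmetry; apply: wl => //; rewrite (negPf ne).
case: x x' => [i u] [i' u'] /= imp /leadingP /= lx /leadingP /= lx'.
rewrite /involves /database /side_info /= => ik ik' kth eqs.
have [thi|thi] := eqVneq th i; last first.
  have thi' : th != i'.
    by apply: contraNneq thi => e; move: imp; rewrite -e eqxx eq_sym.
  by rewrite (negPf thi') => -[<- /erase_inj ->].
have uk : u k != 0 by move: ik; rewrite -thi (negPf kth).
have [j [-> uj minj]] := first_nonzeroP uk.
have [thi'|thi'] := eqVneq th i'.
  have uk' : u' k != 0 by move: ik'; rewrite -thi' (negPf kth).
  have [j' [-> uj' minj']] := first_nonzeroP uk'.
  by move=> [jj' +]; rewrite -jj' -thi -thi' => /erase_inj ->.
move=> [ji' eqe].
have uth' : u' th = 0.
  apply: lx'; rewrite -ji' thi leqNgt; apply: contra uj => ji.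
  by rewrite lx // ltnW.
have := congr1 (fun v : {ffun _ -> _} => \sum_k v k) eqe.
rewrite /= !sum_erase uth' subr0 -eqs => /eqP.
by rewrite subr_eq addrC -subr_eq subrr eq_sym (negPf uj).
Qed.

(** Each download takes a fresh symbol of the desired message, while the other messages reuse the
    positions of its [side_info], so subtracting that download leaves the desired symbol. Within one
    database the positions of every message are distinct ([pos_inj]), hence hidden by independent
    uniform permutations. *)
Lemma symbol_scheme_leading (L : nat) (G : zmodType)
    (label : 'I_K -> 'I_K * {ffun 'I_K -> 'I_n.+1} -> 'I_L) :
  (forall k, {in [pred x | leading x && involves x k] &, injective (label k)}) ->
  (forall k l, exists2 x, leading x && involves x k & label k x = l) ->
  symbol_scheme n.+1 K {ffun 'I_L -> G} G #|[pred x | leading x]|.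
Proof.
move=> label_inj label_surj.
pose pos th x k := label k (if k == th then x else side_info th x).
pose val th (w : {ffun 'I_K -> {perm 'I_L}}) x (W : 'I_K -> {ffun 'I_L -> G}) :=
  \sum_(k | involves x k) W k (w k (pos th x k)).
have pos_inj th k (m : 'I_n.+1) :
    {in [seq x <- enum {: 'I_K * {ffun 'I_K -> 'I_n.+1}} |
          [&& leading x, involves x k & database x == m]] &,
      injective (fun x => pos th x k)}.
  move=> x x'; rewrite !mem_filter => /andP[/and3P[lx ix /eqP dx] _].
  move=> /andP[/and3P[lx' ix' /eqP dx'] _]; rewrite /pos.
  case: eqVneq => [_|kth].
    by apply: label_inj; rewrite inE ?lx ?lx'.
  move=> /label_inj; rewrite !inE !(side_info_leading _ _ kth) //.
  rewrite (side_info_involves _ lx ix) // (side_info_involves _ lx' ix') //.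
  rewrite kth ix ix' => /(_ isT isT) eqs.
  by apply: (side_info_inj lx lx' ix ix' kth) => //; rewrite dx.
exists {ffun 'I_K -> {perm 'I_L}}, {x | leading x}, (fun y => database (sval y)),
  (fun th w y => val th w (sval y)); split.
- by split; exact: [ffun=> 1%g].
- by rewrite card_sig.
- move=> th th' m.
  have /fin_all_exists[tau tauE] k := perm_transport (pos_inj th k m) (pos_inj th' k m).
  exists (fun w : {ffun 'I_K -> {perm 'I_L}} => [ffun k => ((tau k)^-1 * w k)%g]).
    by move=> w w' /ffunP eqw; apply/ffunP => k; have := eqw k; rewrite !ffunE => /mulgI.
  move=> w [x lx] /= dx W; apply: eq_bigr => k ixk; rewrite ffunE permM.
  by rewrite -tauE ?permK // mem_filter lx ixk dx eqxx mem_enum.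
move=> th w W W' eqv; apply/ffunP => l.
have [x /andP[lx ix] labx] := label_surj th ((w th)^-1%g l).
pose inter (V : 'I_K -> {ffun 'I_L -> G}) := \sum_(k | involves x k && (k != th))
  V k (w k (label k (side_info th x))) : G.
have valE V : val th w x V = V th l + inter V.
  rewrite /val (bigD1 th) //= /pos eqxx labx permKV; congr (_ + _).
  by apply: eq_bigr => k /andP[_ /negPf ->].
suff interE : inter W = inter W'.
  by have := eqv (exist (fun y => leading y) x lx); rewrite /= !valE interE => /addIr.
case: (pickP [pred k | involves x k && (k != th)]) => [k /andP[ixk kth]|none]; last first.
  by rewrite /inter !big_pred0.
have ly := side_info_leading lx ixk kth.
have nyth : ~~ involves (side_info th x) th.
  by rewrite (side_info_involves _ lx ixk) // eqxx.
(* The side information does not involve [th], so by [side_info_id] it is its own side information: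
   its value is exactly the interference [inter]. *)
have := eqv (exist (fun y => leading y) _ ly); rewrite /= /val.
suff E (V : 'I_K -> {ffun 'I_L -> G}) : \sum_(j | involves (side_info th x) j)
    V j (w j (pos th (side_info th x) j)) = inter V by rewrite !E.
apply: eq_big => [j|j].
  by rewrite (side_info_involves _ lx ixk) // andbC.
move=> ij; rewrite /pos; case: eqVneq => [jth|_]; last by rewrite side_info_id.
by move: ij; rewrite jth (negPf nyth).
Qed.

End LeadingVectors.

(** * Counting the leading vectors *)

Lemma card_ffun_support (K n : nat) (D : {pred 'I_K}) :
  #|[pred u : {ffun 'I_K -> 'I_n.+1} | [forall j, (j \notin D) ==> (u j == 0)]]|
  = (n.+1 ^ #|D|)%N.
Proof.
rewrite -[X in (X ^ _)%N]card_ord -(card_pffun_on (0 : 'I_n.+1)); apply: eq_card => u.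
rewrite inE; apply/forallP/pffun_onP => [h|[h _] j].
  split=> //; apply/fintype.subsetP => j; apply: contraR => jD.
  by have := h j; rewrite jD.
by apply/implyP; apply: contraR => uj; exact: (fintype.subsetP h).
Qed.

Lemma card_ord_gt (K i : nat) : #|[pred j : 'I_K | (i < j)%N]| = (K - i.+1)%N.
Proof.
rewrite -sum1_card; under eq_bigl do rewrite inE.
by rewrite -(big_geq_mkord i.+1 K xpredT (fun=> 1%N)) sum_nat_const_nat muln1.
Qed.

Lemma sum_telescope_stop (K k : nat) (f : nat -> nat) :
  (forall i, f i.+1 <= f i)%N -> (k < K)%N ->
  (\sum_(i < K) (if i < k then f i - f i.+1 else if i == k :> nat then f i else 0))%N
  = f 0%N.
Proof.
elim: K k f => // K IHK [|k] f fdec kK; rewrite big_ord_recl /=.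
  by rewrite big1 ?addn0.
by rewrite (IHK k (f \o succn)) /= ?subnK // => i; exact: fdec.
Qed.

Section LeadingCount.
Variables (K n : nat).
Implicit Types (u : {ffun 'I_K -> 'I_n.+1}) (i k : 'I_K).

Lemma card_leading_at i : #|[pred u : {ffun 'I_K -> 'I_n.+1} | leading (i, u)]| = (n.+1 ^ (K - i.+1))%N.
Proof.
rewrite -card_ord_gt -(card_ffun_support n); apply: eq_card => u; rewrite !inE.
by apply: eq_forallb => j; rewrite !inE -leqNgt.
Qed.

Lemma card_leading_at0 i k : (i < k)%N ->
  #|[pred u : {ffun 'I_K -> 'I_n.+1} | leading (i, u) && (u k == 0)]| = (n.+1 ^ (K - i.+2))%N.
Proof.
move=> ik; have -> : (K - i.+2)%N = #|[pred j : 'I_K | (i < j)%N && (j != k)]|.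
  rewrite subnS -(card_ord_gt K i).
  rewrite [in LHS](cardD1 k) inE ik /=; apply: eq_card => j.
  by rewrite !inE andbC.
rewrite -(card_ffun_support n); apply: eq_card => u; rewrite !inE.
apply/andP/forallP => [[/leadingP /= lead /eqP uk] j|h].
  by rewrite !inE negb_and negbK -leqNgt; apply/implyP => /orP[/lead ->|/eqP ->]; rewrite ?uk.
split; last by have := h k; rewrite !inE eqxx andbF.
by apply/leadingP => j /= ji; have := h j; rewrite !inE negb_and -leqNgt ji => /eqP.
Qed.

Lemma card_pairs (P : pred ('I_K * {ffun 'I_K -> 'I_n.+1})) :
  #|P| = (\sum_i #|[pred u | P (i, u)]|)%N.
Proof.
rewrite -sum1_card (eq_bigl P) // (eq_bigl (fun x => P (x.1, x.2))); last by case.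
rewrite -(pair_big_dep xpredT (fun i u => P (i, u)) (fun _ _ => 1%N)) /=.
by apply: eq_bigr => i _; rewrite -sum1_card.
Qed.

Lemma card_leading :
  #|[pred x : 'I_K * {ffun 'I_K -> 'I_n.+1} | leading x]| = (\sum_(i < K) n.+1 ^ i)%N.
Proof.
rewrite card_pairs (reindex_inj rev_ord_inj) /=; apply: eq_bigr => i _.
rewrite card_leading_at /=; congr (_ ^ _)%N; have := ltn_ord i; lia.
Qed.

(** Split by the leading position [i], with N = [n.+1]. For [i < k] the entry at [k] must be
    nonzero, leaving N^(K-i-1) - N^(K-i-2) vectors; [i = k] imposes nothing more, and [i > k] forces
    that entry to 0. The sum telescopes. *)
Lemma card_leading_involves k :
  #|[pred x : 'I_K * {ffun 'I_K -> 'I_n.+1} | leading x && involves x k]|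
  = (n.+1 ^ K.-1)%N.
Proof.
have -> : (n.+1 ^ K.-1)%N = (n.+1 ^ (K - 0.+1))%N by rewrite subn1.
rewrite -(@sum_telescope_stop K k (fun m => n.+1 ^ (K - m.+1))%N) //; last first.
  by move=> m; rewrite leq_pexp2l // leq_sub2l.
rewrite card_pairs; apply: eq_bigr => i _.
case: ssrnat.ltngtP => [ik|ki|ik].
- rewrite -card_leading_at -(card_leading_at0 ik).
  rewrite -[in RHS](cardID [pred u : {ffun 'I_K -> 'I_n.+1} | u k == 0]).
  have -> : #|[predI [pred u : {ffun 'I_K -> 'I_n.+1} | leading (i, u)] & [pred u : {ffun 'I_K -> 'I_n.+1} | u k == 0]]| =
     #|[pred u : {ffun 'I_K -> 'I_n.+1} | leading (i, u) && (u k == 0)]| by exact: eq_card.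
  rewrite addKn; apply: eq_card => u; rewrite !inE /involves /= andbC.
  by case: eqVneq ik => // ->; rewrite ltnn.
- rewrite eq_card0 // => u; rewrite !inE /involves /=.
  apply/negP => /andP[/leadingP /= lead /orP[/eqP e|]]; last by rewrite lead ?eqxx // ltnW.
  by rewrite e ltnn in ki.
- rewrite -card_leading_at; apply: eq_card => u.
  by rewrite !inE /involves /= -val_eqE /= ik eqxx andbT.
Qed.

End LeadingCount.

Lemma labelling (T : finType) (P : {pred T}) (L : nat) :
  (0 < L)%N -> #|P| = L ->
  exists2 f : T -> 'I_L, {in P &, injective f} & forall l, exists2 x, x \in P & f x = l.
Proof.
move=> L0 cP; have [x0 Px0] : exists x, x \in P by apply/card_gt0P; rewrite cP.
exists (fun x => cast_ord cP (enum_rank_in Px0 x)) => [x y Px Py|l].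
  by move=> /cast_ord_inj /(congr1 enum_val); rewrite !enum_rankK_in.
exists (enum_val (cast_ord (esym cP) l)); first exact: enum_valP.
by rewrite enum_valK_in cast_ordKV.
Qed.

Lemma symbol_scheme_full (N K : nat) (G : zmodType) : (0 < N)%N ->
  symbol_scheme N K {ffun 'I_(N ^ K.-1) -> G} G (\sum_(i < K) N ^ i).
Proof.
case: N => // n _; rewrite -card_leading.
have lab (k : 'I_K) := labelling (expn_gt0 n.+1 K.-1) (card_leading_involves n k).
have /fin_all_exists2[label label_inj label_surj] := lab.
by apply: (@symbol_scheme_leading K n _ G label).
Qed.

(** * Messages of arbitrary length *)

Lemma symbol_scheme_card (N K D : nat) (A A' : finType) (B : Type) :
  (#|A| <= #|A'|)%N -> symbol_scheme N K A' B D -> symbol_scheme N K A B D.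
Proof.
move=> cA; apply: (@symbol_scheme_inj _ _ _ _ _ _
  (fun a => enum_val (widen_ord cA (enum_rank a)))).
move=> a b /enum_val_inj /(congr1 val) /= eqab.
by apply: enum_rank_inj; apply: val_inj.
Qed.

Section BlockLength.
Variables (N K : nat) (G : finZmodType).
Local Notation block L D := (symbol_scheme N K {ffun 'I_L -> G} G D).

Lemma block_add (L1 L2 D1 D2 : nat) :
  block L1 D1 -> block L2 D2 -> block (L1 + L2)%N (D1 + D2)%N.
Proof.
move=> s1 s2; apply: symbol_scheme_card (symbol_scheme_prod s1 s2).
by rewrite card_prod !card_ffun !card_ord expnD.
Qed.

Lemma block_mul (a L D : nat) : block L D -> block (a * L)%N (a * D)%N.
Proof.
move=> s; elim: a => [|a IHa]; last by rewrite !mulSn; exact: block_add.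
rewrite !mul0n; apply: (@symbol_scheme_card _ _ _ _ unit _ _ (symbol_scheme_unit _ _ _)).
by rewrite card_ffun !card_ord card_unit.
Qed.

Lemma block_length (L : nat) : (0 < N)%N -> (0 < K)%N ->
  exists2 D, block L D &
    (D * N ^ K.-1 < L * (\sum_(i < K) N ^ i) + N ^ K.-1)%N.
Proof.
move=> N0 K0.
set P := (N ^ K.-1)%N; set S := (\sum_(i < K) N ^ i)%N.
have full : block P S := symbol_scheme_full _ _ N0.
have P0 : (0 < P)%N by rewrite expn_gt0 N0.
(* A single database leaves no blocks of [N.-1] symbols to divide by; there [P = 1], and full blocks
   alone fit every length. *)
have [N1|N1] := leqP N 1.
  have P1 : P = 1%N by rewrite /P (_ : N = 1%N) ?exp1n //; lia.
  exists (L * S)%N; last by lia.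
  by have := block_mul L full; rewrite P1 muln1.
have SE : (S * N.-1 + 1 = N * P)%N.
  by rewrite mulnC /S -predn_exp addn1 prednK ?expn_gt0 ?N0 // /P -expnS prednK.
have [m [t [rE tN]]] : exists m t, (L %% P = m * N.-1 + t)%N /\ (t < N.-1)%N.
  exists (L %% P %/ N.-1)%N, (L %% P %% N.-1)%N.
  by rewrite -divn_eq ltn_mod; split=> //; lia.
have LE : L = (L %/ P * P + (m * N.-1 + t))%N by rewrite -rE -divn_eq.
have rP : (m * N.-1 + t < P)%N by rewrite -rE ltn_mod.
have padded (j : nat) : (j < N)%N -> block j j.+1 by exact: symbol_scheme_padded.
have empty : block 0%N 0%N by have := block_mul 0 full; rewrite !mul0n.
have sm : block (m * N.-1)%N (m * N)%N.
  by have := block_mul m (padded N.-1 _); rewrite prednK //; apply; lia.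
(* [uE] is the required bound multiplied by [N.-1], after [SE] and cancellation of the full blocks
   and of the [m] blocks, each of which loses 1/P of a download. For [t > 0] it reduces to m(N-1) +
   t < tP, which follows from [rP]. *)
have [u su uE] : exists2 u, block t u &
    (u * P * N.-1 + m * N.-1 < t * (N * P - 1) + P * N.-1)%N.
  have [t0|t0] := posnP t; first by exists 0%N; [rewrite t0|nia].
  by exists t.+1; [apply: padded; lia|nia].
exists (L %/ P * S + (m * N + u))%N.
  by rewrite [X in block X _]LE; do !apply: block_add => //; apply: block_mul.
rewrite [X in (_ < X * _ + _)%N]LE -(ltn_pmul2r (m := N.-1)); last by lia.
have -> : (((L %/ P * P + (m * N.-1 + t)) * S + P) * N.-1 =
  L %/ P * P * (S * N.-1) + (m * N.-1 + t) * (S * N.-1) + P * N.-1)%N by nia.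
nia.
Qed.
End BlockLength.

(** * From combinatorial schemes to PIR schemes *)

(* The point [t] only serves the pointed structure of measurable types. *)
Definition discrete (T : Type) (t : T) : Type := T.

Section Discrete.
Local Open Scope classical_set_scope.
Variables (T : Type) (t : T).
HB.instance Definition _ := gen_eqMixin (discrete t).
HB.instance Definition _ := gen_choiceMixin (discrete t).
HB.instance Definition _ := isPointed.Build (discrete t) t.
HB.instance Definition _ := @isMeasurable.Build default_measure_display
  (discrete t) discrete_measurable discrete_measurable0 discrete_measurableC
  discrete_measurableU.
End Discrete.

Definition of_discrete (T : Type) (t : T) (d : measure_display)
  (Y : measurableType d) (f : T -> Y) : discrete t -> Y := f.

Section OfDiscrete.
Variables (T : Type) (t : T) (d : measure_display) (Y : measurableType d) (f : T -> Y).
Let measurable_of_discrete : measurable_fun setT (of_discrete (t := t) f).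
Proof. by []. Qed.
HB.instance Definition _ := isMeasurableFun.Build _ _ _ _ (of_discrete (t := t) f)
  measurable_of_discrete.
End OfDiscrete.

Section Uniform.
Local Open Scope classical_set_scope.
Variables (R : realType) (T : finType) (t : T).

Definition counting_enum : {measure set (discrete t) -> \bar R} :=
  msum (fun i => \d_(nth t (enum T) i : discrete t)) #|T|.

Lemma counting_enumE A : counting_enum A = (\sum_(x : T) \d_(x : discrete t) A)%E.
Proof.
by rewrite /= /msum cardE -(big_mkord xpredT (fun i => \d_(nth t (enum T) i : discrete t) A))
  -(big_nth t xpredT (fun x => \d_(x : discrete t) A)) big_enum.
Qed.

(** The Dirac mass is the fallback of [mnormalize] for total mass zero or infinity; here the mass is
    [#|T|], positive because of [t]. *)
Definition uniform_discrete : probability (discrete t) R :=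
  mnormalize counting_enum (dirac (t : discrete t)).

Lemma uniform_discrete_bij (s : T -> T) (A B : set (discrete t)) :
  injective s -> (forall x, A x = B (s x)) ->
  uniform_discrete A = uniform_discrete B.
Proof.
move=> s_inj AB.
have cT : counting_enum [set: discrete t] = #|T|%:R%:E.
  rewrite counting_enumE (eq_bigr (fun=> 1%:E)); last by move=> x _; rewrite diracT.
  by rewrite sumEFin sumr_const.
have T0 : (0 < #|T|)%N by apply/card_gt0P; exists t.
rewrite /uniform_discrete /= /mnormalize cT /= eqe pnatr_eq0 (gtn_eqF T0) /=; congr (_ * _)%E; rewrite !counting_enumE.
rewrite [RHS](reindex_inj s_inj) /=; apply: eq_bigr => x _; rewrite !diracE.
by have -> : (x \in A) = (s x \in B) by apply/idP/idP; rewrite !in_setE AB.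
Qed.

End Uniform.

Section OfSymbolScheme.
Variables (R : realType) (N K L M p : nat).
Hypotheses (M0 : (0 < M)%N).
Variables (Om X : finType) (db : X -> 'I_N).
Variable (val : 'I_K -> Om -> X -> messages K L M -> 'I_p).
Hypothesis priv : forall (th th' : 'I_K) (n : 'I_N),
  exists2 s : Om -> Om, injective s &
    forall w x, db x = n -> val th' (s w) x =1 val th w x.
Hypothesis correct : forall th w W W',
  (forall x, val th w x W = val th w x W') -> W th = W' th.
Variables (th0 : 'I_K) (w0 : Om).

Let len (n : 'I_N) : nat := #|[pred x | db x == n]|.

Let answer (th : 'I_K) (w : Om) (n : 'I_N) (W : messages K L M) :
    (len n).-tuple 'I_p :=
  [tuple val th w (enum_val i) W | i < len n].

(** The query is the answer map itself, as a function of the messages, and the database evaluates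
    it. Privacy then only asks for equal laws of these maps, and the discrete sigma-algebra settles
    measurability. [answer th0 w0 n] serves as base point. *)
Let query_type (n : 'I_N) := discrete (answer th0 w0 n).

Let space := discrete w0.

Let query (th : 'I_K) (n : 'I_N) : {RV (uniform_discrete R w0) >-> query_type n} :=
  @of_discrete _ w0 _ (query_type n) (fun w => answer th w n).

Lemma answer_correct th w W W' :
  (forall n, answer th w n W = answer th w n W') -> W th = W' th.
Proof.
move=> eqa; apply: (@correct th w) => x.
have dbx : x \in [pred y | db y == db x] by rewrite inE.
have := congr1 (fun s => tnth s (enum_rank_in dbx x)) (eqa (db x)).
by rewrite !tnth_mktuple enum_rankK_in.
Qed.

Lemma answer_priv th th' n : exists2 s : Om -> Om, injective s &
  forall w, answer th' (s w) n = answer th w n.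
Proof.
have [s s_inj sE] := priv th th' n; exists s => // w.
apply/funext => W; apply: eq_from_tnth => i; rewrite !tnth_mktuple sE //.
by have := enum_valP i; rewrite inE => /eqP.
Qed.

Let decodable (th : 'I_K) :
    exists decode : (forall n : 'I_N, query_type n) ->
                    ('I_N -> seq 'I_p) -> L.-tuple 'I_M,
      forall (w : space) (W : messages K L M),
        decode (fun n => query th n w)
               (fun n => tval ((query th n w : messages K L M -> _) W)) = W th.
Proof.
have : forall qa : (forall n : 'I_N, query_type n) * ('I_N -> seq 'I_p),
    exists r : L.-tuple 'I_M, forall w W, qa.1 = (fun n => query th n w) ->
      qa.2 = (fun n => tval (answer th w n W)) -> r = W th.
  move=> [q a] /=.
  have [[w [W [eqq eqa]]]|none] := pselect (exists w W,
      q = (fun n => query th n w) /\ a = (fun n => tval (answer th w n W))).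
    (* Equal queries are equal answer maps, so [W'] gets the same answers under [w] as under [w'],
       and correctness at the single [w] compares [W] with [W']. *)
    exists (W th) => w' W' eqq' eqa'; apply: (@answer_correct th w) => n.
    have qw : q n = answer th w n by rewrite eqq.
    have qw' : q n = answer th w' n by rewrite eqq'.
    have aw : a n = tval (answer th w n W) by rewrite eqa.
    have aw' : a n = tval (answer th w' n W') by rewrite eqa'.
    by apply: val_inj; transitivity (a n); [rewrite aw|rewrite aw' -qw' qw].
  exists [tuple of nseq L (Ordinal M0)] => w W eqq eqa.
  by case: none; exists w, W.
by move=> /choice[f fP]; exists (fun q a => f (q, a)) => w W; exact: (fP (_, _) w W erefl erefl).
Qed.

Let query_priv (th th' : 'I_K) (n : 'I_N) :
  identically_distributed (query th n) (query th' n).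
Proof.
move=> A _; have [s s_inj sE] := answer_priv th th' n.
apply: (uniform_discrete_bij R s_inj) => x; rewrite /preimage /= /of_discrete.
by rewrite sE.
Qed.

Definition pir_of_symbol_scheme : pir_scheme R N K L M p :=
  @PIRScheme R N K L M p default_measure_display space (uniform_discrete R w0)
    (fun=> default_measure_display) query_type query (fun n _ => len n)
    (fun n q W => (q : messages K L M -> (len n).-tuple 'I_p) W)
    (fun _ _ _ => I) decodable query_priv.

Lemma pir_of_symbol_scheme_cost : is_download_cost pir_of_symbol_scheme #|X|.
Proof.
have cost th w : @pir_download _ _ _ _ _ _ pir_of_symbol_scheme th w = #|X|.
  rewrite /pir_download /= -sum1_card (partition_big db xpredT) //=.
  by apply: eq_bigr => n _; rewrite /len -sum1_card.
split=> [|th w]; last by rewrite cost.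
by exists th0, w0; rewrite cost.
Qed.

End OfSymbolScheme.

Lemma symbol_scheme_cost (R : realType) (N K L M p D : nat) :
  (0 < M)%N -> (0 < K)%N -> symbol_scheme N K (L.-tuple 'I_M) 'I_p D ->
  exists S : pir_scheme R N K L M p, is_download_cost S D.
Proof.
move=> M0 K0 [Om [X [db [val [[w0] <- priv corr]]]]].
exists (pir_of_symbol_scheme R M0 priv corr (Ordinal K0) w0).
exact: pir_of_symbol_scheme_cost.
Qed.

(** * Entropy of uniform messages *)

Section Entropy.
Variables (R : realType) (T : finType).
Implicit Types (e g : rel T) (x y z : T).

Definition class_size e x : nat := #|[pred y | e x y]|.

(* Conditional entropy of a uniform point of [T]: the observed quantities enter
   only through the equivalence relations "not distinguished by". *)
Definition cond_entropy e g : R :=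
  #|T|%:R^-1 * \sum_x (ln (class_size g x)%:R -
                       ln (class_size (fun a b => e a b && g a b) x)%:R).

Lemma equiv_refl e : equivalence_rel e -> reflexive e.
Proof. by move=> h x; have [] := h x x x. Qed.

Lemma equiv_sym e : equivalence_rel e -> symmetric e.
Proof.
move=> h x y; have hx z := h x y z; have hy z := h y x z.
by apply/idP/idP => [/(hx x).2|/(hy y).2]; rewrite (equiv_refl h) => <-.
Qed.

Lemma equiv_trans e : equivalence_rel e -> transitive e.
Proof. by move=> h y x z exy; rewrite (h x y z).2. Qed.

Lemma equiv_and e g : equivalence_rel e -> equivalence_rel g ->
  equivalence_rel (fun x y => e x y && g x y).
Proof.
move=> he hg x y z; split; first by rewrite !equiv_refl.
by case/andP=> exy gxy; rewrite (he x y z).2 // (hg x y z).2.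
Qed.

Lemma class_size_gt0 e x : equivalence_rel e -> 0 < (class_size e x)%:R :> R.
Proof.
by move=> he; rewrite ltr0n; apply/card_gt0P; exists x; rewrite inE equiv_refl.
Qed.

Lemma eq_class_size e x y : equivalence_rel e -> e x y -> class_size e x = class_size e y.
Proof. by move=> he exy; apply: eq_card => z; rewrite !inE (he x y z).2. Qed.

Lemma sum_inv_class_size e x : equivalence_rel e ->
  \sum_(y | e x y) (class_size e y)%:R^-1 = 1 :> R.
Proof.
move=> he; have c0 := class_size_gt0 x he.
rewrite -[RHS](mulVf (lt0r_neq0 c0)) mulr_natr -sumr_const; apply: eq_bigr => y exy.
by rewrite (eq_class_size he exy).
Qed.

Lemma class_sizeE e x : (class_size e x)%:R = \sum_y (e x y)%:R :> R.
Proof.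
rewrite /class_size -sum1_card natr_sum big_mkcond /=; apply: eq_bigr => y _.
by rewrite inE; case: (e x y).
Qed.

Lemma ln_le_sub1 (x : R) : 0 < x -> ln x <= x - 1.
Proof. by move=> x0; have := @le_ln1Dx R (x - 1); rewrite addrCA subrr addr0; apply; lra. Qed.

Lemma le_cond_entropy e e' g :
  equivalence_rel e -> equivalence_rel e' -> equivalence_rel g ->
  (forall x y, e x y -> e' x y) -> cond_entropy e' g <= cond_entropy e g.
Proof.
move=> he he' hg ee'; rewrite ler_wpM2l ?invr_ge0 // ler_sum // => x _.
rewrite lerD2l lerN2 ler_ln ?posrE ?class_size_gt0 //; try exact: equiv_and.
rewrite ler_nat; apply: subset_leq_card; apply/fintype.subsetP => y.
by rewrite !inE => /andP[/ee' -> ->].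
Qed.

Lemma cond_entropy_true g : cond_entropy (fun _ _ => true) g = 0.
Proof. by rewrite /cond_entropy big1 ?mulr0 // => x _; rewrite subrr. Qed.

Lemma cond_entropy_ge0 e g :
  equivalence_rel e -> equivalence_rel g -> 0 <= cond_entropy e g.
Proof. by move=> he hg; rewrite -(cond_entropy_true g) le_cond_entropy. Qed.

(** Subadditivity of entropy, from ln z <= z - 1 at z = ab/(cd). The products [a x * b x] count
    pairs (y, z); for a fixed pair the admissible [x] are empty or one class of [e12g], over which
    the 1/c sum to 1, while [d] is constant on a class of [g]. Each [y] thus contributes at most
    1. *)
Lemma cond_entropy_and e1 e2 g :
  equivalence_rel e1 -> equivalence_rel e2 -> equivalence_rel g ->
  cond_entropy (fun x y => e1 x y && e2 x y) g <= cond_entropy e1 g + cond_entropy e2 g.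
Proof.
move=> h1 h2 hg; rewrite -mulrDr ler_wpM2l ?invr_ge0 // -big_split /= -subr_ge0.
rewrite -sumrB -oppr_le0 -sumrN.
pose e1g := fun x y => e1 x y && g x y; pose e2g := fun x y => e2 x y && g x y.
pose e12g := fun x y => (e1 x y && e2 x y) && g x y.
have h1g : equivalence_rel e1g := equiv_and h1 hg.
have h2g : equivalence_rel e2g := equiv_and h2 hg.
have h12g : equivalence_rel e12g := equiv_and (equiv_and h1 h2) hg.
pose a x : R := (class_size e1g x)%:R; pose b x : R := (class_size e2g x)%:R.
pose c x : R := (class_size e12g x)%:R; pose d x : R := (class_size g x)%:R.
have a0 x : 0 < a x by exact: class_size_gt0.
have b0 x : 0 < b x by exact: class_size_gt0.
have c0 x : 0 < c x by exact: class_size_gt0.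
have d0 x : 0 < d x by exact: class_size_gt0.
rewrite (eq_bigr (fun x => ln (a x * b x / (c x * d x)))); last first.
  move=> x _; rewrite ln_div ?posrE ?mulr_gt0 // !lnM ?posrE //.
  rewrite -/e1g -/e2g -/e12g -/(a x) -/(b x) -/(c x) -/(d x); ring.
apply: (@le_trans _ _ (\sum_x (a x * b x / (c x * d x) - 1))).
  by apply: ler_sum => x _; rewrite ln_le_sub1 // divr_gt0 ?mulr_gt0.
rewrite sumrB subr_le0 sumr_const.
pose F x y z : R := (e1g x y && e2g x z)%:R / (c x * d x).
rewrite (eq_bigr (fun x => \sum_y \sum_z F x y z)); last first.
  move=> x _; rewrite /a /b !class_sizeE big_distrlr /= mulr_suml; apply: eq_bigr => y _.
  by rewrite mulr_suml; apply: eq_bigr => z _; rewrite -natrM mulnb.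
rewrite exchange_big /=; under eq_bigr do rewrite exchange_big /=.
rewrite -sumr_const; apply: ler_sum => y _.
have dE : d y = \sum_z (g y z)%:R by exact: class_sizeE.
rewrite -[leRHS](mulfV (lt0r_neq0 (d0 y))) [X in _ <= X / _]dE mulr_suml.
apply: ler_sum => z _.
case: (pickP [pred x | e1g x y && e2g x z]) => [x0 /andP[xy xz]|none]; last first.
  rewrite big1; first by rewrite divr_ge0 // ltW.
  by move=> x _; rewrite /F; have /= -> := none x; rewrite mul0r.
have gyz : g y z.
  have /andP[_ gxy] := xy; have /andP[_ gxz] := xz.
  by rewrite (equiv_trans hg _ gxz) // equiv_sym.
rewrite gyz mul1r -[leRHS]mul1r -(sum_inv_class_size x0 h12g) mulr_suml [leRHS]big_mkcond /=.
apply: ler_sum => x _; rewrite /F.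
have -> : e1g x y && e2g x z = e12g x0 x.
  rewrite (equiv_sym h1g x) (equiv_sym h2g x) -(h1g x0 y x).2 // -(h2g x0 z x).2 //.
  by rewrite /e1g /e2g /e12g; do !case: (_ x0 x).
case: ifP => [/andP[_ gx0x]|_]; last by rewrite mul0r.
rewrite mul1r invfM; suff -> : d x = d y by [].
have /andP[_ gxy] := xy.
by rewrite /d -(eq_class_size hg gx0x) (eq_class_size hg gxy).
Qed.

Lemma cond_entropy_all (I : Type) (s : seq I) (e : I -> rel T) g :
  (forall i, equivalence_rel (e i)) -> equivalence_rel g ->
  cond_entropy (fun x y => all (fun i => e i x y) s) g
    <= \sum_(i <- s) cond_entropy (e i) g.
Proof.
move=> he hg; elim: s => [|i s IHs]; first by rewrite big_nil cond_entropy_true.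
rewrite big_cons; apply: le_trans (lerD (lexx _) IHs); apply: cond_entropy_and => //.
elim: s {IHs} => [|j s IHs] /=; first by [].
exact: equiv_and.
Qed.

(** The bound ln z <= z - 1 again, now against the uniform law on [U]: each nonempty fibre of [f]
    contributes 1 to the sum of inverse class sizes, and there are at most [#|U|] of them. *)
Lemma cond_entropy_le_ln_card (U : finType) (f : T -> U) g :
  (0 < #|T|)%N -> (forall x y, g x y) ->
  cond_entropy (fun x y => f x == f y) g <= ln #|U|%:R.
Proof.
move=> T0 gT; pose e x y := f x == f y.
have he : equivalence_rel e by move=> x y z; split=> [|/eqP]; rewrite /e ?eqxx // => ->.
have T0r : 0 < #|T|%:R :> R by rewrite ltr0n.
have U0 : 0 < #|U|%:R :> R.
  by have /card_gt0P[x _] := T0; rewrite ltr0n; apply/card_gt0P; exists (f x).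
rewrite /cond_entropy mulrC ler_pdivrMr // mulr_natr -sumr_const -subr_le0 -sumrB.
apply: (@le_trans _ _ (\sum_x (#|T|%:R / #|U|%:R / (class_size e x)%:R - 1))).
  apply: ler_sum => x _; apply: le_trans (ln_le_sub1 _); last first.
    by rewrite !divr_gt0 // class_size_gt0.
  have -> : class_size g x = #|T| by apply: eq_card => y; rewrite !inE gT.
  have -> : class_size (fun a b => (f a == f b) && g a b) x = class_size e x.
    by apply: eq_card => y; rewrite !inE gT andbT.
  by rewrite !ln_div ?posrE ?divr_gt0 ?class_size_gt0 // addrAC.
rewrite sumrB -mulr_sumr sumr_const subr_le0 -mulrA ger_pMr // mulrC ler_pdivrMr // mul1r.
rewrite (partition_big f xpredT) //= -sumr_const; apply: ler_sum => u _.
case: (pickP [pred x | f x == u]) => [x0 /eqP fx0|none]; last by rewrite big_pred0.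
rewrite (eq_bigl (e x0)) ?sum_inv_class_size // => x.
by rewrite /e fx0 eq_sym.
Qed.

(** Chain rule for a decoded message: [e] together with [g] already gives [g'], so the joint classes
    coincide and only the conditioning class shrinks, by the factor [r]. *)
Lemma cond_entropy_decode e g g' (r : nat) :
  (0 < #|T|)%N -> equivalence_rel e -> equivalence_rel g' -> (0 < r)%N ->
  (forall x y, g' x y -> g x y) -> (forall x y, e x y -> g x y -> g' x y) ->
  (forall x, class_size g x = r * class_size g' x)%N ->
  cond_entropy e g = ln r%:R + cond_entropy e g'.
Proof.
move=> T0 he hg' r0 g'g gg' gE.
have T0r : #|T|%:R != 0 :> R by rewrite pnatr_eq0 -lt0n.
rewrite -[ln _](mulKf T0r) -mulrDr; congr (_ * _).
rewrite mulr_natl -sumr_const -big_split /=; apply: eq_bigr => x _.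
rewrite gE natrM lnM ?posrE ?ltr0n ?class_size_gt0 //; last first.
  by rewrite -(ltr0n R) class_size_gt0.
rewrite addrA; congr (_ - ln _%:R); apply: eq_card => y; rewrite !inE.
by apply: andb_id2l => exy; apply/idP/idP => [/(gg' _ _ exy)|/g'g].
Qed.

End Entropy.

(** * Entropy of the answers given the first messages *)

Section EntropyStep.
Variables (R : realType) (N K : nat) (A : finType) (B : eqType).
Implicit Types (a b : {ffun 'I_K -> A}).

Definition agree (k : nat) : rel {ffun 'I_K -> A} :=
  fun a b => [forall j : 'I_K, (j < k)%N ==> (a j == b j)].

Lemma agreeP k a b : reflect (forall j : 'I_K, (j < k)%N -> a j = b j) (agree k a b).
Proof.
apply: (iffP forallP) => h j; first by move=> jk; have := h j; rewrite jk => /eqP.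
by apply/implyP => /h /eqP.
Qed.

Lemma equiv_agree k : equivalence_rel (agree k).
Proof.
move=> a b c; split; first by apply/agreeP.
by move=> /agreeP ab; apply/agreeP/agreeP => h j jk; rewrite -h // ab.
Qed.

Lemma class_size_agree k a : (k < K)%N ->
  class_size (agree k) a = (#|A| * class_size (agree k.+1) a)%N.
Proof.
have sizeE m : class_size (agree m) a = (\prod_(j < K) if (j < m)%N then 1 else #|A|)%N.
  rewrite /class_size (eq_card (B := family (fun j : 'I_K =>
    if (j < m)%N then pred1 (a j) else predT))); last first.
    move=> b; rewrite inE; apply/agreeP/familyP => [h j|h j jm].
      by case: ifP => // jm; rewrite inE h.
    by have := h j; rewrite jm inE => /eqP.
  rewrite card_family foldrE big_image /=; apply: eq_bigr => j _.
  by case: ifP; rewrite ?card1.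
move=> kK; rewrite !sizeE (bigD1 (Ordinal kK)) //= ltnn; congr (_ * _)%N.
rewrite [RHS](bigD1 (Ordinal kK)) //= ltnSn mul1n; apply: eq_bigr => j jk.
suff -> : (j < k.+1)%N = (j < k)%N by [].
by rewrite ltnS leq_eqVlt -[X in X || _]/(j == Ordinal kK) (negPf jk).
Qed.

Variable ans : 'I_N -> {ffun 'I_K -> A} -> B.

Definition same_answer (n : 'I_N) : rel {ffun 'I_K -> A} :=
  fun a b => ans n a == ans n b.

Lemma equiv_same_answer n : equivalence_rel (same_answer n).
Proof. by move=> a b c; split=> [|/eqP]; rewrite /same_answer ?eqxx // => ->. Qed.

(** With [e] the joint answers: subadditivity bounds their entropy above by the sum, decoding
    message [th] splits off ln [#|A|], and what remains is at least each single entropy, hence their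
    average. *)
Lemma entropy_step (th : 'I_K) : (0 < N)%N -> (0 < #|A|)%N ->
  (forall a b, (forall n, ans n a = ans n b) -> a th = b th) ->
  ln #|A|%:R + N%:R^-1 * \sum_n cond_entropy R (same_answer n) (agree th.+1)
    <= \sum_n cond_entropy R (same_answer n) (agree th).
Proof.
move=> N0 A0 decode.
pose e a b := all (fun n => same_answer n a b) (enum 'I_N).
have eP a b : reflect (forall n, ans n a = ans n b) (e a b).
  apply: (iffP allP) => h n; first by apply/eqP/h; rewrite mem_enum.
  by move=> _; apply/eqP.
have he : equivalence_rel e.
  move=> a b c; split; first by apply/eP.
  by move=> /eP ab; apply/eP/eP => h n; rewrite -h ab.
rewrite -[leRHS](big_enum _ _ _ (fun n => cond_entropy R (same_answer n) (agree th))) /=.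
apply: le_trans (cond_entropy_all R (enum 'I_N) equiv_same_answer (equiv_agree th)).
rewrite -/e (@cond_entropy_decode _ _ e (agree th) (agree th.+1) #|A|) //.
- rewrite lerD2l mulrC ler_pdivrMr ?ltr0n // mulr_natr -[N in leRHS]card_ord -sumr_const.
  apply: ler_sum => n _; apply: le_cond_entropy => //.
  + exact: equiv_same_answer.
  + exact: equiv_agree.
  + by move=> a b /eP /(_ n) /eqP.
- have [x0 _] := card_gt0P A0; apply/card_gt0P; exists [ffun=> x0] => //.
- exact: equiv_agree.
- by move=> a b /agreeP h; apply/agreeP => j jk; apply: h; exact: ltnW.
- move=> a b /eP /decode ab /agreeP h; apply/agreeP => j; rewrite ltnS leq_eqVlt.
  by case/orP => [/eqP/val_inj ->|/h].
- by move=> a; apply: class_size_agree.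
Qed.

End EntropyStep.

(** * The lower bound *)

Section MeasurableFibers.
Local Open Scope classical_set_scope.

Lemma measurable_fun_fibers (d d' : measure_display) (T : measurableType d)
    (Y : measurableType d') (U : finType) (h : T -> U) (g : U -> Y) :
  (forall u, measurable [set q | h q = u]) -> measurable_fun setT (g \o h).
Proof.
move=> mh _ B _; rewrite setTI.
have -> : (g \o h) @^-1` B = \bigcup_(u in [set u | B (g u)]) [set q | h q = u].
  by apply/seteqP; split => [q Bq|q [u /= Bu hqu]]; [exists (h q)|rewrite /= hqu].
by apply: fin_bigcup_measurable => [|u _]; [exact: finite_finset|exact: mh].
Qed.

(** Two answers agree when both equal some common value, a countable union of measurable events
    because [C] is countable; a whole table is a finite intersection of such events and their
    complements. *)
Lemma measurable_rel_fibers (d : measure_display) (T : measurableType d)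
    (U : finType) (C : countType) (f : T -> U -> C) (u : {ffun U * U -> bool}) :
  (forall x s, measurable [set q | f q x = s]) ->
  measurable [set q | [ffun p => f q p.1 == f q p.2] = u].
Proof.
move=> mf.
have meq (x y : U) : measurable [set q | f q x = f q y].
  have -> : [set q | f q x = f q y] =
      \bigcup_(s : C) ([set q | f q x = s] `&` [set q | f q y = s]).
    by apply/seteqP; split => [q /= e|q [s _ [/= -> ->]]] //; exists (f q y).
  by apply: countable_bigcupT_measurable => // s; exact: measurableI.
have -> : [set q | [ffun p => f q p.1 == f q p.2] = u] =
    \bigcap_(p : U * U) [set q | (f q p.1 == f q p.2) = u p].
  apply/seteqP; split => [q /= <- p _|q h] /=; first by rewrite ffunE.
  by apply/ffunP => p; rewrite ffunE; exact: h.
apply: fin_bigcap_measurable => [|p _]; first exact: finite_finset.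
case: (u p).
  rewrite (_ : [set _ | _] = [set q | f q p.1 = f q p.2]); first exact: meq.
  by apply/seteqP; split => q /=; [move/eqP|move/eqP].
rewrite (_ : [set _ | _] = ~` [set q | f q p.1 = f q p.2]); first exact/measurableC/meq.
by apply/seteqP; split => q /=; [move/eqP|move/eqP/negPf].
Qed.

End MeasurableFibers.

Section Converse.
Local Open Scope classical_set_scope.
Variables (R : realType) (N K L M p : nat) (S : pir_scheme R N K L M p).
Hypotheses (N0 : (0 < N)%N) (M0 : (0 < M)%N).
Local Notation tuples := ({ffun 'I_K -> L.-tuple 'I_M}).
Local Notation P := (pir_prob S).

Let answer (n : 'I_N) (q : pir_query_type S n) (W : tuples) : seq 'I_p :=
  tval (pir_answer q W).

Definition query_entropy (k : nat) (n : 'I_N) (q : pir_query_type S n) : R :=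
  cond_entropy R (fun a b : tuples => answer q a == answer q b) (agree k).

Lemma query_entropy_ge0 k n (q : pir_query_type S n) : 0 <= query_entropy k q.
Proof.
apply: cond_entropy_ge0; last exact: equiv_agree.
exact: (equiv_same_answer (fun=> answer q) n).
Qed.

(** The entropy depends on the query only through the finite table [h q] of message pairs that are
    answered alike, whatever the set of queries. *)
Lemma measurable_query_entropy k n :
  measurable_fun setT ((fun q => (query_entropy k q)%:E) : pir_query_type S n -> \bar R).
Proof.
apply/measurable_EFinP.
pose h (q : pir_query_type S n) : {ffun tuples * tuples -> bool} :=
  [ffun p => answer q p.1 == answer q p.2].
pose g (u : {ffun tuples * tuples -> bool}) : R :=
  cond_entropy R (fun a b : tuples => u (a, b)) (agree k).
have -> : @query_entropy k n = g \o h.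
  apply/funext => q; rewrite /g /= /query_entropy; congr cond_entropy.
  by apply/funext => a; apply/funext => b; rewrite ffunE.
apply: measurable_fun_fibers => u.
apply: (@measurable_rel_fibers _ _ tuples (seq 'I_p) (fun q W => answer q W)).
by move=> W s; exact: pir_answer_measurable.
Qed.

Lemma integral_const (x : R) : (\int[P]_w x%:E = x%:E)%E.
Proof.
rewrite (integral_cst P measurableT) -[RHS]mule1; congr (_ * _)%E.
exact: probability_setT.
Qed.

Definition expected_entropy (k : nat) (th : 'I_K) : \bar R :=
  (\sum_(n < N) \int[P]_w (query_entropy k (pir_query S th n w))%:E)%E.

(** Each summand is an integral against the law of one query, which privacy makes independent of the
    desired index. *)
Lemma expected_entropy_private k th th' :
  expected_entropy k th = expected_entropy k th'.
Proof.
apply: eq_bigr => n _.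
have E t : (\int[P]_w (query_entropy k (pir_query S t n w))%:E =
    \int[distribution P (pir_query S t n)]_q (query_entropy k q)%:E)%E.
  rewrite ge0_integral_pushforward //.
  - exact: measurable_query_entropy.
  - by move=> q _; rewrite lee_fin query_entropy_ge0.
rewrite !E; apply: eq_measure_integral => A mA _.
exact: (pir_private th th' mA).
Qed.

Lemma measurable_query_entropy_comp k th n :
  measurable_fun setT
    ((fun w => (query_entropy k (pir_query S th n w))%:E) : pir_space S -> \bar R).
Proof.
exact: (measurableT_comp (@measurable_query_entropy k n) (measurable_funPT (pir_query S th n))).
Qed.

Lemma expected_entropyE k th : expected_entropy k th =
  (\int[P]_w (\sum_(n < N) (query_entropy k (pir_query S th n w))%:E))%E.
Proof.
rewrite ge0_integral_sum //.
- by move=> n; exact: measurable_query_entropy_comp.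
- by move=> n w _; rewrite lee_fin query_entropy_ge0.
Qed.

Lemma expected_entropy_ge0 k th : (0 <= expected_entropy k th)%E.
Proof.
by apply: sume_ge0 => n _; apply: integral_ge0 => w _; rewrite lee_fin query_entropy_ge0.
Qed.

Lemma measurable_total_entropy k th : measurable_fun setT
  ((fun w => \sum_(n < N) (query_entropy k (pir_query S th n w))%:E)%E :
    pir_space S -> \bar R).
Proof. by apply: emeasurable_sum => n; exact: measurable_query_entropy_comp. Qed.

Lemma expected_entropy_step (th : 'I_K) :
  ((L%:R * ln M%:R)%:E + (N%:R^-1)%:E * expected_entropy th.+1 th
    <= expected_entropy th th)%E.
Proof.
have lnM0 : 0 <= L%:R * ln M%:R :> R by rewrite mulr_ge0 // ln_ge0 // ler1n.
have sum0 k w : (0 <= \sum_(n < N) (query_entropy k (pir_query S th n w))%:E)%E.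
  by apply: sume_ge0 => n _; rewrite lee_fin query_entropy_ge0.
have msum k := measurable_total_entropy k th.
have -> : (L%:R * ln M%:R)%:E = (\int[P]_w (L%:R * ln M%:R)%:E)%E.
  by rewrite integral_const.
pose F w : \bar R :=
  (\sum_(n < N) (query_entropy th.+1 (pir_query S th n w))%:E)%E.
have F0 w : (0 <= (N%:R^-1)%:E * F w)%E by apply: mule_ge0; [rewrite lee_fin invr_ge0|exact: sum0].
have mF : measurable_fun setT (fun w => (N%:R^-1)%:E * F w)%E.
  exact: measurable_funeM (msum th.+1).
have -> : ((N%:R^-1)%:E * expected_entropy th.+1 th =
    \int[P]_w ((N%:R^-1)%:E * F w))%E.
  rewrite expected_entropyE ge0_integralZl_EFin ?invr_ge0 //.
  - by move=> w _; exact: sum0.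
  - exact: (msum th.+1).
rewrite expected_entropyE -ge0_integralD //.
apply: ge0_le_integral => //.
- by move=> w _; rewrite adde_ge0 // lee_fin.
- exact: emeasurable_funD.
move=> w _; rewrite /F !sumEFin -EFinM -EFinD lee_fin.
have cA : #|{: L.-tuple 'I_M}|%:R = M%:R ^+ L :> R by rewrite card_tuple card_ord natrX.
rewrite mulr_natl -lnXn ?ltr0n // -cA.
apply: (@entropy_step R N K _ _ (fun n => answer (pir_query S th n w))) => //.
  by rewrite card_tuple card_ord expn_gt0 M0.
move=> a b ab; have [decode decodeE] := pir_correct S th.
rewrite -(decodeE w a) -(decodeE w b); congr (decode _ _).
by apply/funext => n; exact: ab.
Qed.

(** [agree 0] relates all messages, and a fixed query fixes the answer length, so each downloaded
    symbol carries at most ln p. *)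
Lemma expected_entropy_upper (D : nat) (th : 'I_K) : (0 < p)%N ->
  (forall w : pir_space S, (pir_download th w <= D)%N) ->
  (expected_entropy 0 th <= (D%:R * ln p%:R)%:E)%E.
Proof.
move=> p0 len_le.
have lnp0 : 0 <= ln p%:R :> R by rewrite ln_ge0 // ler1n.
have -> : (D%:R * ln p%:R)%:E = (\int[P]_w (D%:R * ln p%:R)%:E)%E.
  by rewrite integral_const.
rewrite expected_entropyE; apply: ge0_le_integral => //.
- by move=> w _; apply: sume_ge0 => n _; rewrite lee_fin query_entropy_ge0.
- exact: measurable_total_entropy.
move=> w _; rewrite sumEFin lee_fin.
apply: (@le_trans _ _ (\sum_(n < N) (pir_len (pir_query S th n w))%:R * ln p%:R)).
  apply: ler_sum => n _; rewrite mulr_natl -lnXn ?ltr0n // -natrX.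
  have <- : #|{: (pir_len (pir_query S th n w)).-tuple 'I_p}| =
      (p ^ pir_len (pir_query S th n w))%N by rewrite card_tuple card_ord.
  apply: (@cond_entropy_le_ln_card R tuples _ (pir_answer (pir_query S th n w))).
    apply/card_gt0P; exists [ffun=> [tuple of nseq L (Ordinal M0)]] => //.
  by move=> a b; apply/agreeP.
by rewrite -mulr_suml -natr_sum ler_wpM2r // ler_nat len_le.
Qed.

Lemma download_lower_bound (D : nat) : (0 < K)%N -> (0 < p)%N ->
  is_download_cost S D ->
  L%:R * ln M%:R * (\sum_(k < K) (N%:R ^+ k)^-1) <= D%:R * ln p%:R :> R.
Proof.
move=> K0 p0 [_ maxD].
pose x : R := L%:R * ln M%:R.
(* [j] counts the messages not yet conditioned on; the induction starts with all [K] messages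
   known. *)
have lower j : (j <= K)%N -> forall th : 'I_K,
    ((x * \sum_(i < j) (N%:R ^+ i)^-1)%:E <= expected_entropy (K - j) th)%E.
  elim: j => [_ th|j IHj jK th].
    by rewrite big_ord0 mulr0 expected_entropy_ge0.
  have ltK : (K - j.+1 < K)%N by lia.
  (* Privacy lets the desired message be the first one not conditioned on, as
     [expected_entropy_step] requires. *)
  rewrite (expected_entropy_private _ th (Ordinal ltK)).
  apply: le_trans (expected_entropy_step (Ordinal ltK)).
  have -> : (Ordinal ltK).+1 = (K - j)%N by rewrite /=; lia.
  have := IHj (ltnW jK) (Ordinal ltK).
  rewrite big_ord_recl expr0 invr1 mulrDr mulr1 EFinD => IH.
  apply: leeD => //.
  have -> : x * \sum_(i < j) (N%:R ^+ lift ord0 i)^-1 =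
      N%:R^-1 * (x * \sum_(i < j) (N%:R ^+ i)^-1).
    rewrite [RHS]mulrCA; congr (_ * _); rewrite mulr_sumr; apply: eq_bigr => i _.
    by rewrite /= exprS invfM.
  by rewrite EFinM lee_wpmul2l // lee_fin invr_ge0.
have := lower K (leqnn K) (Ordinal K0); rewrite subnn => low.
rewrite -lee_fin; apply: le_trans low _.
exact: expected_entropy_upper.
Qed.

End Converse.

(** * The optimal download cost *)

Lemma sum_expn_inv (R : realType) (N K : nat) : (0 < N)%N ->
  (\sum_(i < K) N ^ i)%N%:R = (N ^ K.-1)%N%:R * \sum_(k < K) (N%:R ^+ k)^-1 :> R.
Proof.
move=> N0; have NR0 : N%:R != 0 :> R by rewrite pnatr_eq0 -lt0n.
rewrite natr_sum (reindex_inj rev_ord_inj) mulr_sumr /=; apply: eq_bigr => i _.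
have -> : (K.-1 = K - i.+1 + i)%N by have := ltn_ord i; lia.
by rewrite !natrX exprD mulfK // expf_neq0.
Qed.

(** Divided by [N ^ K.-1] this reads 1/C < 2, which limits the loss from rounding to two symbols. *)
Lemma sum_expn_lt (N K : nat) : (1 < N)%N -> (0 < K)%N ->
  (\sum_(i < K) N ^ i < 2 * N ^ K.-1)%N.
Proof.
move=> N1 K0; have := predn_exp N K.
rewrite -[K in (N ^ K).-1]prednK // expnS.
have : (0 < N ^ K.-1)%N by rewrite expn_gt0 ltnW.
move: (\sum_(i < K) N ^ i)%N (N ^ K.-1)%N => S P P0 E.
have : (N.-1 * S < N.-1 * (2 * P))%N by rewrite -E; nia.
by rewrite ltn_pmul2l //; lia.
Qed.

Lemma optimal_download_cost_exists (R : realType) (N K L M p D : nat)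
    (S : pir_scheme R N K L M p) : is_download_cost S D ->
  exists2 D', is_optimal_download_cost R N K L M p D' & (D' <= D)%N.
Proof.
move=> costS.
pose P n := `[< exists S' : pir_scheme R N K L M p, is_download_cost S' n >].
have PD : P D by apply/asboolP; exists S.
have exP : exists n, P n by exists D.
case: (ex_minnP exP) => D' /asboolP[S' costS'] minD'.
exists D'; last exact: minD'.
split; first by exists S'.
by move=> S'' n costn; apply: minD'; apply/asboolP; exists S''.
Qed.

(** Here [L] plays the role of the rounded length and [s] that of 1/C. The block scheme gives D0 <
    Ls + 1, hence at most the ceiling; the converse gives Ls < (x + 1)s <= D + s. *)
Lemma ceil_nat_bounds (R : realType) (N K L D D0 : nat) (x : R) :
  (0 < N)%N -> (0 < K)%N -> (1 < N)%N \/ (K <= 3)%N -> 0 <= x ->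
  let s := \sum_(k < K) (N%:R ^+ k)^-1 in
  (D <= D0)%N -> (D0 * N ^ K.-1 < L * (\sum_(i < K) N ^ i) + N ^ K.-1)%N ->
  L%:R < x + 1 -> x * s <= D%:R ->
  D%:Z = Num.ceil (L%:R * s) \/ D%:Z = Num.ceil (L%:R * s) - 1 \/
  D%:Z = Num.ceil (L%:R * s) - 2.
Proof.
move=> N0 K0 hNK x0 s DD0 upper Lx lower.
have P0 : 0 < (N ^ K.-1)%N%:R :> R by rewrite ltr0n expn_gt0 N0.
have up : D0%:Z <= Num.ceil (L%:R * s).
  rewrite -ltzD1 -(ltr_int R) rmorphD /=.
  have : D0%:R < L%:R * s + 1.
    rewrite -(ltr_pM2r P0) mulrDl mul1r -mulrA (mulrC s) -sum_expn_inv //.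
    by rewrite -!natrM -natrD ltr_nat.
  have := ceil_ge (L%:R * s); lra.
have s1 : 1 <= s.
  rewrite /s; case: (K) K0 => // k _; rewrite big_ord_recl expr0 invr1 lerDl.
  by apply: sumr_ge0 => i _; rewrite invr_ge0 exprn_ge0.
have low : Num.ceil (L%:R * s) <= D%:Z + 2.
  rewrite ceil_le_int rmorphD /=.
  have Ls : L%:R * s < D%:R + s.
    have s0 : 0 < s by lra.
    have : L%:R * s < (x + 1) * s by rewrite ltr_pM2r.
    by lra.
  have [N1|N1] := ltnP 1 N.
    have s2 : s < 2.
      rewrite -(ltr_pM2l P0) -sum_expn_inv // mulrC -natrM ltr_nat.
      exact: sum_expn_lt.
    by apply: ltW; lra.
  (* With one database s = K, so Ls < D + s is a strict inequality between integers: LK <= D + K -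
     1, which is at most D + 2 when K <= 3. *)
  have N1E : N = 1%N by lia.
  have sK : s = K%:R.
    rewrite /s N1E (eq_bigr (fun=> 1)); last by move=> k _; rewrite expr1n invr1.
    by rewrite sumr_const card_ord.
  case: hNK => [|K3]; first by lia.
  move: Ls; rewrite sK -natrM -natrD ltr_nat => Ls.
  by rewrite -[X in _ <= X](natrD R D 2) ler_nat; lia.
by move: (Num.ceil _) up low => c up low; lia.
Qed.

Theorem theorem2 (R : realType) (N K L M M' : nat)
    (hN : (0 < N)%N) (hK : (0 < K)%N) (hL : (0 < L)%N)
    (hM : (1 < M)%N) (hM' : (1 < M')%N) (hMM' : M' <> M)
    (hNK : (1 < N)%N \/ (K <= 3)%N) :
  let C : R := pir_capacity R N K in
  let L' : int := Num.ceil (L%:R * log_base (M'%:R : R) M%:R) in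
  exists D_L : nat,
    is_optimal_download_cost R N K L M M' D_L /\
    (D_L%:Z = Num.ceil (L'%:~R / C) \/
     D_L%:Z = Num.ceil (L'%:~R / C) - 1 \/
     D_L%:Z = Num.ceil (L'%:~R / C) - 2).
Proof.
move=> C L'.
have lnM : 0 < ln M%:R :> R by rewrite ln_gt0 // ltr1n.
have lnM' : 0 < ln M'%:R :> R by rewrite ln_gt0 // ltr1n.
set x : R := L%:R * log_base (M'%:R : R) M%:R in L' *.
have x0 : 0 <= x by rewrite mulr_ge0 // divr_ge0 // ltW.
have xE : x * ln M'%:R = L%:R * ln M%:R by rewrite /x /log_base -mulrA mulfVK // gt_eqF.
have [l lE] : exists l : nat, L' = l%:Z.
  exists `|L'|%N; rewrite gez0_abs // -(ler_int R).
  exact: le_trans x0 (ceil_ge x).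
have xl : x <= l%:R by have := ceil_ge x; rewrite -/L' lE.
have lx : l%:R < x + 1.
  by have := ceilB1_lt x; rewrite -/L' lE; lra.
have card_le : (M ^ L <= M' ^ l)%N.
  have M0 : 0 < (M ^ L)%N%:R :> R by rewrite ltr0n expn_gt0 ltnW.
  have M'0 : 0 < (M' ^ l)%N%:R :> R by rewrite ltr0n expn_gt0 ltnW.
  rewrite -(ler_nat R) -ler_ln ?posrE // !natrX !lnXn ?ltr0n ?(ltnW hM) ?(ltnW hM') //.
  by rewrite -[ln M%:R *+ L]mulr_natl -[ln M'%:R *+ l]mulr_natl -xE ler_wpM2r // ltW.
have [D0 block D0_lt] : exists2 D0, symbol_scheme N K (L.-tuple 'I_M) 'I_M' D0 &
    (D0 * N ^ K.-1 < l * (\sum_(i < K) N ^ i) + N ^ K.-1)%N.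
  (* The successor form makes the download alphabet the cyclic group in which symbols are summed. *)
  case: (M') hM' card_le => // p _ card_le.
  have [D0 block D0_lt] := block_length 'I_p.+1 l hN hK.
  exists D0 => //; apply: symbol_scheme_card block.
  by rewrite card_tuple card_ffun !card_ord.
have [S costS] := symbol_scheme_cost R (ltnW hM) hK block.
have [D optD DD0] := optimal_download_cost_exists costS.
have [[S' costS'] _] := optD.
exists D; split=> //.
have := download_lower_bound hN (ltnW hM) hK (ltnW hM') costS'.
rewrite -xE mulrAC ler_pM2r // => lower.
rewrite lE /C /pir_capacity invrK.
exact: (ceil_nat_bounds hN hK hNK x0 DD0 D0_lt lx lower).
Qed.
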